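(* Let $d\ge 1$ and $1\le m\le d$. If $A\in PL_d$, then $R_m^{(d)}\cdot A=R_m^{(d)}$.
   Context: Matrices have entries in a field $k$. A $d\times d$ matrix is a Permutation-Like Matrix (PLM) if all its entries are $0$ or $1$ and each column contains exactly one entry equal to $1$; $PL_d$ is the set of all $d\times d$ PLM. $R_m^{(d)}$ is the $d\times d$ matrix whose $m$-th row consists of $1$s and all of whose other entries are $0$. *)

(* Defs.v *)
From mathcomp Require Import all_boot all_order all_algebra.

Set Implicit Arguments.
Unset Strict Implicit.
Unset Printing Implicit Defensive.

Import GRing.Theory.
Local Open Scope ring_scope.

(* Permutation-like matrices; the second conjunct counts the 1s of column j. *)
Definition PL (k : fieldType) (d : nat) : {pred 'M[k]_d} :=
  [pred A : 'M[k]_d |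
    [forall i, forall j, (A i j == 0) || (A i j == 1)] &&
    [forall j, #|[set i | A i j == 1]| == 1%N]].

(* Rows are numbered from 0, so m : 'I_d stands for the (m + 1)-th row. *)
Definition Rmx (k : fieldType) (d : nat) (m : 'I_d) : 'M[k]_d :=
  \matrix_(i, j) (if i == m then 1 else 0).

Arguments PL : clear implicits.
Arguments Rmx : clear implicits.

(* Main.v *)
Require Import Defs.
From mathcomp Require Import all_boot all_order all_algebra.
Import GRing.Theory.
Local Open Scope ring_scope.

(** Each row of [Rmx k d m] is constant, so the [(i, j)] entry of the product is that constant times
    the sum of column [j] of [A]. By [PL_col_sum] this sum is 1, its only nonzero term being the
    single 1 of the column. *)

Lemma PL_col_sum (k : fieldType) (d : nat) (A : 'M[k]_d) (j : 'I_d) :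
  A \in PL k d -> \sum_i A i j = 1.
Proof.
case/andP=> /forallP A01 /forallP /(_ j) /cards1P [i0 Ei0].
have A1E i : (A i j == 1) = (i == i0).
  by move/setP/(_ i): Ei0; rewrite !inE.
rewrite (bigD1 i0) //= big1 ?addr0; first by apply/eqP; rewrite A1E.
move=> i ne_i; apply/eqP.
(* Off row [i0] the entry is 0 or 1 but not 1, hence 0. *)
by move/forallP/(_ j): (A01 i); rewrite A1E (negbTE ne_i) orbF.
Qed.

Theorem proposition3p9 (k : fieldType) (d : nat) (hd : (1 <= d)%N) (m : 'I_d)
    (A : 'M[k]_d) (hA : A \in PL k d) :
  Rmx k d m *m A = Rmx k d m.
Proof.
apply/matrixP=> i j; rewrite !mxE.
under eq_bigr => l _ do rewrite mxE.
(* The factor [if i == m then 1 else 0] does not depend on [l], so it leaves the sum. *)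
by rewrite -mulr_sumr PL_col_sum // mulr1.
Qed.
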